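(* Let $E$ be a countably Dedekind complete Riesz space, let $V\subset E$ (with the order inherited from $E$), and let $(V,\mathbb T)$ with $\mathbb T=\{T_\sigma:\sigma\in\Sigma\}$ be a regular abstract dynamic program. Let $V$ be countably chain complete. If $(V,\mathbb T)$ is absolutely order contracting, then (i) the fundamental optimality properties hold for $(V,\mathbb T)$, and (ii) VFI, OPI and HPI all converge.
   Context: For elements $v\le w$ of a poset, $[v,w]=\{u:v\le u\le w\}$ is an order interval. A poset $V$ is countably chain complete if it is order bounded (i.e. $V$ itself is an order interval $[a,b]$ with $a,b\in V$) and every countable chain in $V$ has a supremum and an infimum in $V$. A poset is countably Dedekind complete if every order interval in it is countably chain complete. In a poset, write $v_n\uparrow v$ if $(v_n)$ is increasing with supremum $v$, and $v_n\downarrow v$ if it is decreasing with infimum $v$. A self-map $K$ on $E$ is order continuous if $v_n\uparrow v$ in $E$ implies $Kv_n\uparrow Kv$. A sequence $(v_n)$ in $E$ order converges to $v\in E$, written $v_n\stackrel{o}{\to}v$, if there is a sequence $d_n\downarrow0$ in $E$ with $|v_n-v|\le d_n$ for all $n\in\mathbb N$. A self-map $S$ on $V\subset E$ is absolutely order contracting on $V$ if there exists an order continuous linear operator $K:E\to E$ such that, for all $v,w\in V$, $|Sv-Sw|\le K|v-w|$ and $K^n|v-w|\stackrel{o}{\to}0$. $(V,\mathbb T)$ is absolutely order contracting if each $T_\sigma\in\mathbb T$ is absolutely order contracting on $V$ (the operator $K$ may depend on $\sigma$). Abstract dynamic programs. An abstract dynamic program (ADP) is a pair $(V,\mathbb T)$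 where $V=(V,\preceq)$ is a poset (here $\preceq$ is the order inherited from $E$) and $\mathbb T=\{T_\sigma:\sigma\in\Sigma\}$ is a nonempty family of order preserving self-maps on $V$; elements of $\Sigma$ are called policies. Given $v\in V$, $\sigma\in\Sigma$ is $v$-greedy if $T_\tau v\preceq T_\sigma v$ for all $\tau\in\Sigma$. The Bellman operator is $Tv:=\bigvee_\sigma T_\sigma v$ whenever the supremum exists; $v\in V$ solves the Bellman equation if $Tv$ exists and $Tv=v$. $(V,\mathbb T)$ is well-posed if each $T_\sigma$ has a unique fixed point $v_\sigma$ in $V$, and regular if a $v$-greedy policy exists for every $v\in V$. When $(V,\mathbb T)$ is well-posed, $V_\Sigma:=\{v_\sigma:\sigma\in\Sigma\}$; $\sigma$ is optimal if $v_\sigma$ is a greatest element of $V_\Sigma$; and the value function is $v^*:=\bigvee V_\Sigma$ whenever the supremum exists. Bellman's principle of optimality holds if $(V,\mathbb T)$ is well-posed and $\{\sigma\in\Sigma:\sigma\text{ is optimal}\}=\{\sigma\in\Sigma:\sigma\text{ is }v^*\text{-greedy}\}$ (both sets understood as empty if $v^*$ does not exist). The fundamental optimality properties hold if $(V,\mathbb T)$ is well-posed and regular and: (B1) at least one optimal policy exists; (B2) $v^*$ is the unique solution to the Bellman equation in $V$; (B3) Bellman's principle of optimality holds. Algorithms. Fix, for each $v\in V$, a choice of $v$-greedy policy $\sigma$. Set $Hv:=v_\sigma$ (Howard policy operator) and, for $m\in\mathbb N$, $m\ge1$, $W_mv:=T_\sigma^m v$ (optimistic policy operator), where $\sigma$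 is the chosen $v$-greedy policy. Let $V_U=\{v\in V:v\preceq Tv\}$. VFI converges if $T^nv\uparrow v^*$ for all $v\in V_U$; OPI converges if $W_m^nv\uparrow v^*$ for all $v\in V_U$ (for each $m$); HPI converges if $H^nv\uparrow v^*$ for all $v\in V_U$. *)

(* Defs.v *)
From HB Require Import structures.
From mathcomp Require Import all_boot all_order all_algebra.
From mathcomp Require Import boolp classical_sets functions cardinality.
From mathcomp Require Import reals sequences.

Set Implicit Arguments.
Unset Strict Implicit.
Unset Printing Implicit Defensive.

Import Order.TTheory GRing.Theory.

Local Open Scope classical_set_scope.
Local Open Scope order_scope.

(* The type of a set, [set_type V], is such a sigma type, hence a poset for the
   inherited order.  Suprema and infima in [set_type V] below are those of this
   poset; they may a priori differ from those of the ambient poset. *)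
HB.instance Definition _ (d : Order.disp_t) (P : porderType d) (p : pred P) :=
  [SubChoice_isSubPOrder of {x : P | p x} by <: with d].

Section Posets.
Context {d : Order.disp_t} {P : porderType d}.
Implicit Types (u : nat -> P) (v : P).

Definition increases_to u v := nondecreasing_seq u /\ supremums (range u) v.

Definition decreases_to u v := nonincreasing_seq u /\ infimums (range u) v.

Definition order_interval (v w : P) : set P := [set u | v <= u <= w].

End Posets.

Definition countably_chain_complete (d : Order.disp_t) (P : porderType d) :=
  (exists a b : P, order_interval a b = setT) /\
  forall C : set P, countable C -> total_on C <=%O ->
    supremums C !=set0 /\ infimums C !=set0.

Definition countably_dedekind_complete (d : Order.disp_t) (P : porderType d) :=
  forall v w : P, v <= w ->
    countably_chain_complete (set_type (order_interval v w)).

(* The lattice operations are part of the mixin because Hierarchy-Builder does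
   not accept a join of [latticeType] and [zmodType] besides [realDomainType]. *)
HB.mixin Record POrderedZmodule_Lmodule_isRiesz (R : realType) E
    of Num.POrderedZmodule E & GRing.Lmodule R E := {
  riesz_leD2r : forall z x y : E, (x <= y)%R -> (x + z <= y + z)%R ;
  riesz_scale_ge0 : forall (a : R) (x : E),
    (0 <= a)%R -> (0 <= x)%R -> (0 <= a *: x)%R ;
  riesz_join : E -> E -> E ;
  riesz_meet : E -> E -> E ;
  riesz_join_lub : forall x y z : E,
    (riesz_join x y <= z)%R = (x <= z)%R && (y <= z)%R ;
  riesz_meet_glb : forall x y z : E,
    (z <= riesz_meet x y)%R = (z <= x)%R && (z <= y)%R }.

#[short(type="rieszType")]
HB.structure Definition Riesz (R : realType) :=
  { E of Num.POrderedZmodule E & GRing.Lmodule R E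
       & POrderedZmodule_Lmodule_isRiesz R E }.

Section RieszSpaces.
Context {R : realType} {E : rieszType R}.
Implicit Types (v : E) (V : set E).

Definition riesz_abs v : E := riesz_join v (- v)%R.

Definition order_continuous (K : E -> E) :=
  forall (u : nat -> E) v, increases_to u v -> increases_to (K \o u) (K v).

Definition order_converges (u : nat -> E) v :=
  exists2 b : nat -> E, decreases_to b 0%R &
    forall n, riesz_abs (u n - v)%R <= b n.

Definition absolutely_order_contracting V (S : V -> V) :=
  exists2 K : {linear E -> E}, order_continuous K &
    forall v w : V,
      riesz_abs (val (S v) - val (S w))%R <= K (riesz_abs (val v - val w)%R) /\
      order_converges (fun n => iter n K (riesz_abs (val v - val w)%R)) 0%R.

End RieszSpaces.

Record adp (d : Order.disp_t) (V : porderType d) := Adp {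
  policy : Type ;
  policy_nonempty : inhabited policy ;
  policy_op : policy -> V -> V ;
  policy_op_homo : forall s, {homo policy_op s : v w / v <= w} }.

Section AbstractDynamicPrograms.
Context {d : Order.disp_t} {V : porderType d} (A : adp V).
Local Notation Sigma := (policy A).
Local Notation T_ := (@policy_op _ _ A).
Implicit Types (s t : Sigma) (v w : V).

Definition greedy v s := forall t, T_ t v <= T_ s v.

Definition regular := forall v, exists s, greedy v s.

Definition bellman_defined v := supremums (range (fun s => T_ s v)) !=set0.

(* Equal to the junk value [v] when the supremum does not exist. *)
Definition bellman v : V := supremum v (range (fun s => T_ s v)).

Definition solves_bellman v := bellman_defined v /\ bellman v = v.

Definition well_posed := forall s, exists! v, T_ s v = v.

Definition policy_value (wp : well_posed) s : V := sval (cid (wp s)).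

Definition policy_values (wp : well_posed) : set V := range (policy_value wp).

Definition optimal (wp : well_posed) s :=
  ubound (policy_values wp) (policy_value wp s).

Definition value_function (wp : well_posed) v := supremums (policy_values wp) v.

Definition bellman_principle :=
  exists wp : well_posed,
    [set s | optimal wp s] =
    [set s | exists2 v, value_function wp v & greedy v s].

Definition fundamental_optimality :=
  exists wp : well_posed,
    [/\ regular,
        exists s, optimal wp s,
        exists2 v, value_function wp v & forall w, solves_bellman w <-> w = v &
        bellman_principle].

Definition greedy_selector (g : V -> Sigma) := forall v, greedy v (g v).

Definition howard (wp : well_posed) (g : V -> Sigma) v : V :=
  policy_value wp (g v).

Definition optimistic (g : V -> Sigma) (m : nat) v : V := iter m (T_ (g v)) v.

Definition V_up : set V := [set v | bellman_defined v /\ v <= bellman v].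

Definition iterates_converge (wp : well_posed) (F : V -> V) :=
  exists2 vstar, value_function wp vstar &
    forall v, V_up v -> increases_to (fun n => iter n F v) vstar.

Definition vfi_converges :=
  exists wp : well_posed, iterates_converge wp bellman.

Definition opi_converges (g : V -> Sigma) :=
  exists wp : well_posed,
    forall m, (1 <= m)%N -> iterates_converge wp (optimistic g m).

Definition hpi_converges (g : V -> Sigma) :=
  exists wp : well_posed, iterates_converge wp (howard wp g).

End AbstractDynamicPrograms.

Definition adp_absolutely_order_contracting (R : realType) (E : rieszType R)
    (V : set E) (A : adp V) :=
  forall s : policy A, absolutely_order_contracting (@policy_op _ _ A s).

(* Main.v *)
(* If [v <= w] in [V], then [0 <= S^n w - S^n v <= K^n (w - v)], which order
   converges to [0].  Iterating a policy operator from the bottom of [V] thus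
   yields a fixed point lying above every [v <= S v] and below every [v >= S v].
   VFI, OPI and HPI all iterate a map [F] with [T v <= F v <= T (F v)] whenever
   [v <= T v]; the iterates increase to some [w] in [V], and the order continuity
   of [K] for a [w]-greedy policy gives [T w = w].  Every fixed point of [T] is
   the greatest policy value, whence uniqueness and optimality. *)

Require Import Defs.
From mathcomp Require Import all_boot all_order all_algebra.
From mathcomp Require Import boolp classical_sets functions cardinality.
From mathcomp Require Import reals sequences.

Set Implicit Arguments.
Unset Strict Implicit.
Unset Printing Implicit Defensive.

Import Order.TTheory GRing.Theory.

(** * Monotone sequences and iterates of order preserving maps *)

Section Posets.
Context {d : Order.disp_t} {P : porderType d}.
Local Open Scope classical_set_scope.
Local Open Scope order_scope.
Implicit Types (u : nat -> P) (v w : P).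

Lemma nondecreasing_range_total u :
  nondecreasing_seq u -> total_on (range u) <=%O.
Proof.
move=> u_nd _ _ [m _ <-] [n _ <-].
by case: (leqP m n) => [/u_nd|/ltnW/u_nd]; [left|right].
Qed.

Lemma chain_complete_increases_to u :
  countably_chain_complete P -> nondecreasing_seq u ->
  exists v, increases_to u v.
Proof.
move=> [_ P_chain] u_nd.
have [[v uv] _] : supremums (range u) !=set0 /\ infimums (range u) !=set0.
  apply: P_chain (nondecreasing_range_total u_nd).
  exact: card_le_trans (card_image_le _ _) (countableP _).
by exists v.
Qed.

Lemma chain_complete_bottom :
  countably_chain_complete P -> exists a, forall v, a <= v.
Proof.
move=> [[a [b abT]] _]; exists a => v.
by have /andP[] : order_interval a b v by rewrite abT.
Qed.

Lemma increases_to_ub u v n : increases_to u v -> u n <= v.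
Proof. by move=> [_ [ub _]]; apply: ub; exists n. Qed.

Lemma increases_to_lub u v w :
  increases_to u v -> (forall n, u n <= w) -> v <= w.
Proof. by move=> [_ [_ lub]] uw; apply: lub => _ [n _ <-]. Qed.

Lemma iter_homo (S : P -> P) n :
  {homo S : v w / v <= w} -> {homo iter n S : v w / v <= w}.
Proof. by move=> S_homo v w vw; elim: n => //= n; apply: S_homo. Qed.

Lemma iter_expansive (S : P -> P) v n :
  {homo S : v w / v <= w} -> v <= S v -> v <= iter n S v.
Proof.
by move=> S_homo vS; elim: n => //= n /S_homo; apply: le_trans.
Qed.

Lemma iter_contractive (S : P -> P) v n :
  {homo S : v w / v <= w} -> S v <= v -> iter n S v <= v.
Proof.
by move=> S_homo Sv; elim: n => //= n /S_homo/le_trans; apply.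
Qed.

Lemma iter_nondecreasing (S : P -> P) v :
  {homo S : v w / v <= w} -> v <= S v -> nondecreasing_seq (fun n => iter n S v).
Proof.
move=> S_homo vS; apply/nondecreasing_seqP => n.
by rewrite iterSr; apply: iter_homo.
Qed.

End Posets.

(** * Order arithmetic, order continuity and monotone limits in Riesz spaces *)

Section RieszSpaces.
Context {R : realType} {E : rieszType R}.
Local Open Scope classical_set_scope.
Local Open Scope ring_scope.
Implicit Types (x y z : E) (u : nat -> E) (K : {linear E -> E}).

Lemma riesz_leBlDr x y z : (x - y <= z) = (x <= z + y).
Proof.
apply/idP/idP => [/(riesz_leD2r y)|/(riesz_leD2r (- y))].
  by rewrite subrK.
by rewrite addrK.
Qed.

Lemma riesz_leBrDr x y z : (x <= y - z) = (x + z <= y).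
Proof.
apply/idP/idP => [/(riesz_leD2r z)|/(riesz_leD2r (- z))].
  by rewrite subrK.
by rewrite addrK.
Qed.

Lemma riesz_subr_ge0 x y : (0 <= y - x) = (x <= y).
Proof. by rewrite riesz_leBrDr add0r. Qed.

Lemma riesz_subr_le0 x y : (x - y <= 0) = (x <= y).
Proof. by rewrite riesz_leBlDr add0r. Qed.

Lemma riesz_leB x y z t : x <= y -> t <= z -> x - z <= y - t.
Proof.
move=> xy tz; apply: le_trans (riesz_leD2r (- z) _ _ xy) _.
by rewrite riesz_leBlDr addrAC riesz_leBrDr !(addrC y); apply: riesz_leD2r.
Qed.

Lemma riesz_ler_abs x : x <= riesz_abs x.
Proof.
by have := riesz_join_lub x (- x) (riesz_abs x); rewrite lexx => /esym/andP[].
Qed.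

Lemma riesz_ger0_abs x : 0 <= x -> riesz_abs x = x.
Proof.
move=> x0; apply/le_anti; rewrite riesz_ler_abs riesz_join_lub lexx !andbT /=.
by apply: (le_trans _ x0); rewrite -[leLHS]add0r riesz_subr_le0.
Qed.

(** [z] is a lower bound of the dominating sequence, whose infimum is [0]. *)
Lemma order_converges0_ge u z :
  order_converges u 0 -> (forall n, z <= u n) -> z <= 0.
Proof.
move=> [b [_ [_ b_glb]] ub] zu; apply: b_glb => _ [n _ <-].
apply: le_trans (zu n) (le_trans (riesz_ler_abs _) _).
by have := ub n; rewrite subr0.
Qed.

(** The sequence [0, x, x, ...] increases to [x], so its image under [K] is nondecreasing and starts
    at [K 0 = 0]. *)
Lemma order_continuous_ge0 K x : order_continuous K -> 0 <= x -> 0 <= K x.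
Proof.
move=> K_cont x0.
have [|K_nd _] := K_cont (fun n => if n is 0%N then 0 else x) x.
  split; first by apply/nondecreasing_seqP => -[|n].
  by split=> [_ [[|n] _ <-] //|z]; apply; exists 1%N.
by have := K_nd 0%N 1%N isT; rewrite /= raddf0.
Qed.

Lemma order_continuous_homo K : order_continuous K -> {homo K : x y / x <= y}.
Proof.
move=> K_cont x y; rewrite -riesz_subr_ge0 => /(order_continuous_ge0 K_cont).
by rewrite raddfB riesz_subr_ge0.
Qed.

(* An upper bound [z] of [u] need not lie below [w], but its meet with [w] is
   an upper bound in the interval. *)
Lemma dedekind_increases_to u w :
  countably_dedekind_complete E -> nondecreasing_seq u ->
  (forall n, u n <= w) -> exists v, increases_to u v.
Proof.
move=> E_complete u_nd uw.
have u_itv n : u n \in order_interval (u 0%N) w.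
  by rewrite inE /order_interval /= u_nd ?uw.
pose u' n : set_type (order_interval (u 0%N) w) := Sub (u n) (u_itv n).
have [|v [_ [v_ub v_lub]]] :=
    chain_complete_increases_to (u := u') (E_complete _ _ (uw 0%N)).
  by move=> m n /u_nd.
exists (val v); split=> //; split=> [_ [n _ <-]|z z_ub].
  by apply: (v_ub (u' n)); exists n.
have uz n : u n <= z by apply: z_ub; exists n.
have := riesz_meet_glb z w (riesz_meet z w); rewrite lexx => /esym/andP[mz mw].
have m_itv : riesz_meet z w \in order_interval (u 0%N) w.
  by rewrite inE /order_interval /= riesz_meet_glb uz uw mw.
pose m : set_type (order_interval (u 0%N) w) := Sub (riesz_meet z w) m_itv.
suff vm : (v <= m)%O by apply: (le_trans _ mz); apply: vm.
apply: v_lub => _ [n _ <-].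
by apply: (_ : u n <= riesz_meet z w); rewrite riesz_meet_glb uz uw.
Qed.

End RieszSpaces.

(** * Fixed points of absolutely order contracting maps *)

Section ContractingMaps.
Context {R : realType} {E : rieszType R} {V : set E}.
Variable S : set_type V -> set_type V.
Local Open Scope classical_set_scope.
Local Open Scope ring_scope.
Implicit Types v w : set_type V.

Lemma absolutely_order_contracting_le :
  absolutely_order_contracting S ->
  exists2 K : {linear E -> E}, order_continuous K & forall v w, (v <= w)%O ->
    val (S w) - val (S v) <= K (val w - val v) /\
    order_converges (fun n => iter n K (val w - val v)) 0.
Proof.
move=> [K K_cont SK]; exists K => // v w vw; have [SKvw Kvw] := SK w v.
have vw0 : 0 <= val w - val v by rewrite riesz_subr_ge0.
by move: SKvw Kvw; rewrite (riesz_ger0_abs vw0) => /(le_trans (riesz_ler_abs _)).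
Qed.

(** The difference [x - y] is at most [iter n S w - iter n S v], hence at most [iter n K (w - v)],
    for every [n]. *)
Lemma contracting_le_of_iter v w x y :
  {homo S : v w / (v <= w)%O} -> absolutely_order_contracting S ->
  (v <= w)%O -> (forall n, x <= iter n S w)%O -> (forall n, iter n S v <= y)%O ->
  (x <= y)%O.
Proof.
move=> S_homo /absolutely_order_contracting_le[K K_cont SK] vw xw vy.
have SnK n : val (iter n S w) - val (iter n S v) <= iter n K (val w - val v).
  elim: n => //= n IHn; apply: le_trans _ (order_continuous_homo K_cont IHn).
  exact: (SK _ _ (iter_homo n S_homo vw)).1.
have : val x - val y <= 0.
  apply: (order_converges0_ge (SK _ _ vw).2) => n; apply: le_trans _ (SnK n).
  by apply: riesz_leB; [apply: xw|apply: vy].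
by rewrite riesz_subr_le0.
Qed.

Lemma contracting_fixpoint :
  countably_chain_complete (set_type V) ->
  {homo S : v w / (v <= w)%O} -> absolutely_order_contracting S ->
  exists x, [/\ S x = x, forall v, (v <= S v)%O -> (v <= x)%O
    & forall v, (S v <= v)%O -> (x <= v)%O].
Proof.
move=> V_complete S_homo S_contr.
have [a a_min] := chain_complete_bottom V_complete.
have [x ax] := chain_complete_increases_to V_complete
  (iter_nondecreasing S_homo (a_min (S a))).
have le_x v : (S v <= v)%O -> (x <= v)%O.
  move=> Sv; apply: (increases_to_lub ax) => n.
  exact: le_trans (iter_homo n S_homo (a_min v)) (iter_contractive _ S_homo Sv).
have ge_x v : (v <= S v)%O -> (v <= x)%O.
  (* The iterates from [v] stay above [v], those from the bottom [a] stay below [x]. *)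
  move=> vS; apply: (contracting_le_of_iter S_homo S_contr (a_min v)) => n.
    exact: iter_expansive.
  exact: increases_to_ub ax.
have xS : (x <= S x)%O.
  apply: (increases_to_lub ax) => -[|n]; first exact: a_min.
  by apply: S_homo; apply: increases_to_ub ax.
(* Since [x <= S x] gives [S x <= S (S x)], [ge_x] applies to [S x] and yields [S x <= x]. *)
by exists x; split=> //; apply/le_anti; rewrite xS ge_x// S_homo.
Qed.

End ContractingMaps.

(** * Bellman fixed points and optimality in regular programs *)

Section AbstractDynamicPrograms.
Context {d : Order.disp_t} {V : porderType d} (A : adp V).
Local Notation T_ := (@policy_op _ _ A).
Local Open Scope classical_set_scope.
Local Open Scope order_scope.
Implicit Types (s t : policy A) (v w x : V).

(** One half of order stability of the policy operators: this half serves policy iteration,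
    [downward_stable] serves optimality. *)
Definition upward_stable :=
  forall s v x, T_ s x = x -> v <= T_ s v -> v <= x.

Definition downward_stable :=
  forall s v x, T_ s x = x -> T_ s v <= v -> x <= v.

Lemma greedy_supremums v s :
  greedy v s -> supremums (range (fun t => T_ t v)) (T_ s v).
Proof. by move=> vs; split=> [_ [t _ <-] //|w]; apply; exists s. Qed.

Lemma bellman_greedy v s : greedy v s -> bellman A v = T_ s v.
Proof.
move=> /greedy_supremums vs; rewrite /bellman /supremum.
(* [supremum] returns its default on the empty set, which is excluded here as policies exist. *)
have /negPf -> : range (fun t => T_ t v) != set0.
  by apply/set0P; exists (T_ s v), s.
case: xgetP => [w _ vw|/(_ _ vs)//].
exact: is_subset1_supremums vw vs.
Qed.

Hypothesis A_regular : regular A.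

Lemma regular_bellman_defined v : bellman_defined A v.
Proof. by have [s /greedy_supremums] := A_regular v; exists (T_ s v). Qed.

Lemma policy_op_le_bellman s v : T_ s v <= bellman A v.
Proof. by have [t vt] := A_regular v; rewrite (bellman_greedy vt). Qed.

Lemma bellman_homo : {homo bellman A : v w / v <= w}.
Proof.
move=> v w vw; have [s vs] := A_regular v; rewrite (bellman_greedy vs).
exact: le_trans (policy_op_homo s vw) (policy_op_le_bellman s w).
Qed.

Variable wp : well_posed A.

Lemma policy_valueP s : T_ s (policy_value wp s) = policy_value wp s.
Proof. by rewrite /policy_value; case: cid => v []. Qed.

Lemma policy_value_unique s v : T_ s v = v -> policy_value wp s = v.
Proof. by rewrite /policy_value; case: cid => w /= [_]; apply. Qed.

(** From [T_ s v <= v], downward stability puts every policy value below [v]; a [v]-greedy policy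
    has [v] itself as its value. *)
Lemma value_function_bellman_fixpoint v :
  downward_stable -> bellman A v = v -> value_function wp v.
Proof.
move=> down Tv; split=> [_ [s _ <-]|w].
  by apply: (down s); rewrite ?policy_valueP// -[leRHS]Tv policy_op_le_bellman.
have [s vs] := A_regular v.
by apply; exists s => //; apply: policy_value_unique; rewrite -bellman_greedy.
Qed.

(** For a policy [s], being [v]-greedy and being optimal both amount to having value [v]. *)
Lemma fundamental_optimality_bellman_fixpoint v :
  downward_stable -> bellman A v = v -> fundamental_optimality A.
Proof.
move=> down Tv; have vstar := value_function_bellman_fixpoint down Tv.
have vstarE w : value_function wp w -> w = v.
  by move=> vw; apply: is_subset1_supremums vw vstar.
have greedyE s : greedy v s <-> policy_value wp s = v.
  split=> [vs|sv t]; first by apply: policy_value_unique; rewrite -bellman_greedy.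
  by rewrite -[in leRHS]sv policy_valueP sv -[leRHS]Tv policy_op_le_bellman.
have optimalE s : optimal wp s <-> policy_value wp s = v.
  split=> [s_opt|]; last by rewrite /optimal => ->; case: vstar.
  by apply: vstarE; split=> // w; apply; exists s.
exists wp; split=> //.
- by have [s /greedyE sv] := A_regular v; exists s; apply/optimalE.
- exists v => // w; split=> [[_ Tw]|->].
    exact/vstarE/value_function_bellman_fixpoint.
  by split=> //; apply: regular_bellman_defined.
- exists wp; apply/seteqP; split=> s /=.
    by move=> /optimalE/greedyE; exists v.
  by move=> [w /vstarE ->] /greedyE/optimalE.
Qed.

(** The last inequality passes the premise on from [v] to [F v], so that [F] can be iterated. *)
Definition bellman_dominating (F : V -> V) :=
  forall v, v <= bellman A v -> bellman A v <= F v <= bellman A (F v).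

Lemma bellman_dominating_bellman : bellman_dominating (bellman A).
Proof. by move=> v vT; rewrite lexx bellman_homo. Qed.

(** The iterates of [T_ (g v)] from [v] increase: the first is [bellman A v], and one more
    application after the [m]-th is at most a Bellman step. *)
Lemma bellman_dominating_optimistic (g : V -> policy A) m :
  greedy_selector g -> (1 <= m)%N -> bellman_dominating (optimistic g m).
Proof.
move=> g_greedy; case: m => // m _ v; rewrite (bellman_greedy (g_greedy v)) => vT.
have T_homo := policy_op_homo (g v).
rewrite /optimistic iterSr iter_expansive//=; last exact: T_homo.
apply: (le_trans _ (policy_op_le_bellman (g v) _)).
by rewrite -iterS [leRHS]iterSr; apply: iter_homo => //; apply: T_homo.
Qed.

(** Upward stability puts [v] below the value of [g v]; applying [T_ (g v)] fixes that value and
    sends [v] to [bellman A v]. *)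
Lemma bellman_dominating_howard (g : V -> policy A) :
  upward_stable -> greedy_selector g -> bellman_dominating (howard wp g).
Proof.
move=> up g_greedy v; rewrite (bellman_greedy (g_greedy v)) => vT.
have up_v := up _ _ _ (policy_valueP (g v)) vT.
rewrite /howard; apply/andP; split.
  by rewrite -[leRHS]policy_valueP; apply: policy_op_homo.
by rewrite -[leLHS]policy_valueP; apply: policy_op_le_bellman.
Qed.

End AbstractDynamicPrograms.

(** * Convergence in absolutely order contracting programs *)

Section ContractingPrograms.
Context {R : realType} {E : rieszType R} {V : set E} (A : adp (set_type V)).
Local Notation T_ := (@policy_op _ _ A).
Local Open Scope classical_set_scope.
Local Open Scope ring_scope.
Implicit Types v w : set_type V.
Hypothesis E_complete : countably_dedekind_complete E.
Hypothesis V_complete : countably_chain_complete (set_type V).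
Hypothesis A_regular : regular A.
Hypothesis A_contracting : adp_absolutely_order_contracting A.

(* The supremum [w] of [u] in [V] might exceed its supremum [y] in [E].  Order
   continuity of [K] gives [T_ s w - y <= K (w - y)], so that [w <= T_ s w]
   yields [w - y <= iter n K (w - y)] for all [n], whence [w = y]. *)
Lemma increases_to_bellman_fixpoint (u : nat -> set_type V) w :
  increases_to u w -> (forall n, u n <= bellman A (u n))%O ->
  (forall n, bellman A (u n) <= u n.+1)%O -> bellman A w = w.
Proof.
move=> uw uT Tu; have [s ws] := A_regular w.
have [K K_cont SK] := absolutely_order_contracting_le (A_contracting s).
have wT : (w <= T_ s w)%O.
  apply: (increases_to_lub uw) => n; apply: le_trans (uT n) _.
  rewrite -(bellman_greedy ws).
  by apply: bellman_homo => //; apply: increases_to_ub uw.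
have u_le_w n : val (u n) <= val w by apply: (increases_to_ub n uw).
have u_nd : nondecreasing_seq (val \o u) by move=> m n /uw.1.
have [y uy] := dedekind_increases_to E_complete u_nd u_le_w.
have yw : y <= val w by apply: (increases_to_lub uy).
have TKy : val (T_ s w) - y <= K (val w - y).
  (* With [K y] isolated on the left, it suffices to bound each [K (u n)]. *)
  rewrite raddfB riesz_leBrDr addrC -riesz_leBrDr.
  apply: (increases_to_lub (K_cont _ _ uy)) => n /=.
  rewrite riesz_leBrDr addrC -riesz_leBrDr -raddfB.
  apply: le_trans _ (SK _ _ (increases_to_ub n uw)).1.
  (* The chain [T_ s (u n) <= bellman A (u n) <= u n.+1 <= y] is shifted by one index. *)
  apply: riesz_leB => //; apply: le_trans _ (increases_to_ub n.+1 uy).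
  exact: le_trans (policy_op_le_bellman A_regular _ _) (Tu n).
have wyK n : val w - y <= iter n K (val w - y).
  apply: iter_expansive; first exact: order_continuous_homo.
  by apply: le_trans _ TKy; apply: riesz_leB.
have wy : val w = y.
  apply/le_anti; rewrite yw andbT -riesz_subr_le0.
  (* The contraction concerns elements of [V], where [y] need not lie, so [w - y] is first bounded
     by [w - u 0]. *)
  apply: (order_converges0_ge (SK _ _ (increases_to_ub 0%N uw)).2) => n.
  apply: le_trans (wyK n) _; apply: iter_homo; first exact: order_continuous_homo.
  by apply: riesz_leB => //; apply: (increases_to_ub 0%N uy).
rewrite (bellman_greedy ws); apply/le_anti; rewrite wT andbT.
by move: TKy; rewrite -wy subrr raddf0 riesz_subr_le0.
Qed.

Lemma bellman_dominating_iter (F : set_type V -> set_type V) v :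
  bellman_dominating A F -> (v <= bellman A v)%O ->
  exists2 w, increases_to (fun n => iter n F v) w & bellman A w = w.
Proof.
move=> F_dom vT.
have uT n : (iter n F v <= bellman A (iter n F v))%O.
  by elim: n => //= n /F_dom/andP[].
have Tu n : (bellman A (iter n F v) <= iter n.+1 F v)%O.
  by have /andP[] := F_dom _ (uT n).
have [|w uw] := chain_complete_increases_to V_complete (u := fun n => iter n F v).
  by apply/nondecreasing_seqP => n; apply: le_trans (uT n) (Tu n).
by exists w => //; apply: increases_to_bellman_fixpoint uw uT Tu.
Qed.

Lemma contracting_well_posed : well_posed A.
Proof.
move=> s; have [x [Sx ge_x le_x]] :=
  contracting_fixpoint V_complete (@policy_op_homo _ _ A s) (A_contracting s).
by exists x; split=> // v Sv; apply/le_anti; rewrite le_x ?ge_x ?Sv.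
Qed.

Lemma contracting_upward_stable : upward_stable A.
Proof.
move=> s v w Sw; have [x [Sx ge_x le_x]] :=
  contracting_fixpoint V_complete (@policy_op_homo _ _ A s) (A_contracting s).
by move=> /ge_x/le_trans; apply; apply: le_x; rewrite Sw.
Qed.

Lemma contracting_downward_stable : downward_stable A.
Proof.
move=> s v w Sw; have [x [Sx ge_x le_x]] :=
  contracting_fixpoint V_complete (@policy_op_homo _ _ A s) (A_contracting s).
by move=> /le_x; apply: le_trans; apply: ge_x; rewrite Sw.
Qed.

Lemma exists_bellman_fixpoint : exists v, bellman A v = v.
Proof.
have [a a_min] := chain_complete_bottom V_complete.
have [v _ Tv] := bellman_dominating_iter
  (bellman_dominating_bellman A_regular) (a_min (bellman A a)).
by exists v.
Qed.

(** The limit of the iterates is a Bellman fixed point, hence the value function, whatever the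
    starting point. *)
Lemma bellman_dominating_converge (wp : well_posed A) F :
  bellman_dominating A F -> iterates_converge wp F.
Proof.
move=> F_dom; have [v Tv] := exists_bellman_fixpoint.
have value w := value_function_bellman_fixpoint A_regular wp
  contracting_downward_stable (v := w).
exists v => [|v0 [_ /(bellman_dominating_iter F_dom)[w uw Tw]]]; first exact: value.
by rewrite (is_subset1_supremums (value _ Tv) (value _ Tw)).
Qed.

End ContractingPrograms.

Theorem theorem5p3 (R : realType) (E : rieszType R)
    (E_complete : countably_dedekind_complete E)
    (V : set E) (A : adp (set_type V)) (A_regular : regular A)
    (V_complete : countably_chain_complete (set_type V))
    (A_contracting : adp_absolutely_order_contracting A) :
  fundamental_optimality A /\
  (vfi_converges A /\
   forall g : set_type V -> policy A, greedy_selector g ->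
     opi_converges g /\ hpi_converges g).
Proof.
have wp := contracting_well_posed V_complete A_contracting.
have converge := bellman_dominating_converge
  E_complete V_complete A_regular A_contracting wp.
have [v Tv] :=
  exists_bellman_fixpoint E_complete V_complete A_regular A_contracting.
split.
  apply: fundamental_optimality_bellman_fixpoint Tv => //.
  exact: contracting_downward_stable.
split; first by exists wp; apply/converge/bellman_dominating_bellman.
move=> g g_greedy; split; exists wp.
  by move=> m m_gt0; apply/converge/bellman_dominating_optimistic.
apply/converge/bellman_dominating_howard => //.
exact: contracting_upward_stable.
Qed.
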